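(* The sequence $\{T_n\}_{n\ge 1}$ of tangent numbers is almost infinitely log-monotonic.
   Context: The tangent numbers $T_n=T(n)$, $n\ge 1$, are defined by $\tan x=\sum_{n\geq 1}T(n)\frac{x^{2n-1}}{(2n-1)!}$ (so $T(1)=1$, $T(2)=2$, $T(3)=16$, $T(4)=272$, $T(5)=7936$). A sequence $\{a_n\}$ of positive real numbers is log-concave if $a_{n+1}^2\ge a_na_{n+2}$ for all $n$, and log-convex if $a_{n+1}^2\le a_na_{n+2}$ for all $n$. Define an operator $R$ on sequences of positive reals by $R\{z_n\}=\{x_n\}$ with $x_n=z_{n+1}/z_n$, and let $R^r$ be its $r$-fold iterate ($R^0$ is the identity). A sequence $\{z_n\}$ is infinitely log-monotonic if $R^r\{z_n\}$ is log-concave for all odd $r$ and log-convex for all even $r\ge 0$. It is almost infinitely log-monotonic if this holds at each order except for certain terms at the beginning, i.e. for every integer $r\ge 0$ there is $N_r$ such that the sequence $R^r\{z_n\}$ restricted to indices $n\ge N_r$ is log-convex if $r$ is even and log-concave if $r$ is odd. *)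

(* Defs.v *)
From Stdlib Require Import Reals Factorial Lra Lia.
From Coquelicot Require Import Coquelicot.

Open Scope R_scope.

(* A sequence (a_n)_{n >= 1} is a function [a : nat -> R] whose value at 0 is
   ignored: every index below is required to be at least 1. *)

(* The generating identity
     tan x = \sum_{n >= 1} T(n) x^(2n-1) / (2n-1)!
   on some neighbourhood of 0.  Coquelicot's series start at 0, hence [S k].
   The identity determines [T n] for every n >= 1. *)
Definition tangent_numbers (T : nat -> R) : Prop :=
  exists rho : R, 0 < rho /\
    forall x : R, Rabs x < rho ->
      is_series
        (fun k => let n := S k in
                  T n * (x ^ (2 * n - 1) / INR (fact (2 * n - 1))))
        (tan x).

Definition log_concave_from (N : nat) (a : nat -> R) : Prop :=
  (forall n, (N <= n)%nat -> 0 < a n) /\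
  (forall n, (N <= n)%nat -> a (n + 1)%nat ^ 2 >= a n * a (n + 2)%nat).

Definition log_convex_from (N : nat) (a : nat -> R) : Prop :=
  (forall n, (N <= n)%nat -> 0 < a n) /\
  (forall n, (N <= n)%nat -> a (n + 1)%nat ^ 2 <= a n * a (n + 2)%nat).

Definition ratio_op (z : nat -> R) : nat -> R :=
  fun n => z (n + 1)%nat / z n.

(* The first clause says that (z_n)_{n >= 1} is in the domain of the operator,
   the sequences of positive reals; its iterates then are as well. *)
Definition almost_infinitely_log_monotonic (z : nat -> R) : Prop :=
  (forall n, (1 <= n)%nat -> 0 < z n) /\
  forall r : nat, exists N : nat, (1 <= N)%nat /\
    (Nat.Even r -> log_convex_from N (Nat.iter r ratio_op z)) /\
    (Nat.Odd r -> log_concave_from N (Nat.iter r ratio_op z)).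

(* Existence of the tangent numbers.  Writing tan x = x g(x^2), the equation
   tan' = 1 + tan^2 becomes a recurrence for the coefficients of g. *)

Lemma tan_coef_ex : exists b : nat -> R, b O = 1 /\
  forall n, b (S n) = PS_mult b b n / (2 * INR n + 3).
Proof.
  set (tab := fix tab (n : nat) : nat -> R :=
    match n with
    | O => fun _ => 1
    | S m => fun k => if Nat.leb k m then tab m k
                      else PS_mult (tab m) (tab m) m / (2 * INR m + 3)
    end).
  assert (H : forall n k, (k <= n)%nat -> tab n k = tab k k).
  { induction n as [|n IH]; intros k Hk.
    - now replace k with O by lia.
    - destruct (Nat.eq_dec k (S n)) as [->|Hne]; [easy|].
      cbn. rewrite (proj2 (Nat.leb_le k n)) by lia. apply IH; lia. }
  exists (fun n => tab n n). split; [easy|]. intros n.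
  cbn -[INR Nat.leb]. rewrite (proj2 (Nat.leb_gt (S n) n)) by lia.
  f_equal. unfold PS_mult. apply sum_eq. intros i Hi.
  rewrite (H n i), (H n (n - i)%nat) by lia. easy.
Qed.

Lemma tangent_numbers_ex : exists T, tangent_numbers T.
Proof.
  destruct tan_coef_ex as [b [b0 bS]].
  assert (bnd : forall n k, (k <= n)%nat -> 0 <= b k <= 1).
  { induction n as [|n IH]; intros k Hk.
    - replace k with O by lia. rewrite b0. lra.
    - destruct (Nat.eq_dec k (S n)) as [->|Hne]; [|apply IH; lia].
      rewrite bS. pose proof (pos_INR n) as Hn.
      assert (0 <= PS_mult b b n <= INR (S n)) as [H0 H1].
      { unfold PS_mult. split.
        - rewrite <- (Rmult_0_l (INR (S n))), <- (sum_cte 0).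
          apply sum_Rle. intros i Hi.
          destruct (IH i Hi), (IH (n - i)%nat ltac:(lia)). nra.
        - rewrite <- (Rmult_1_l (INR (S n))), <- (sum_cte 1).
          apply sum_Rle. intros i Hi.
          destruct (IH i Hi), (IH (n - i)%nat ltac:(lia)). nra. }
      rewrite S_INR in H1. split.
      + apply Rdiv_le_0_compat; lra.
      + apply Rle_div_l; lra. }
  assert (rad : forall y, Rabs y < 1 -> Rbar_lt (Rabs y) (CV_radius b)).
  { intros y Hy. apply Rbar_lt_le_trans with 1; [exact Hy|].
    apply (proj1 (CV_radius_bounded b)). exists 1. intros n.
    rewrite pow1, Rmult_1_r. destruct (bnd n n (le_n n)).
    rewrite Rabs_pos_eq; lra. }
  set (g := PSeries b).
  assert (ode : forall y, Rabs y < 1 ->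
    g y + 2 * y * PSeries (PS_derive b) y = 1 + y * (g y * g y)).
  { intros y Hy. pose proof (rad y Hy) as Hr. unfold g.
    assert (Hr' : Rbar_lt (Rabs y) (CV_radius (PS_derive b)))
      by (rewrite CV_radius_derive; exact Hr).
    assert (E := CV_radius_inside _ _ Hr).
    assert (E' := CV_radius_inside _ _ Hr').
    rewrite <- PSeries_mult by assumption.
    rewrite (PSeries_decr_1 b y E), b0.
    assert (Ed : ex_pseries (PS_decr_1 b) y)
      by (apply CV_radius_inside; rewrite CV_radius_decr_1; exact Hr).
    transitivity (1 + y * (PSeries (PS_decr_1 b) y
                           + 2 * PSeries (PS_derive b) y)); [ring|].
    rewrite <- (PSeries_scal 2).
    rewrite <- PSeries_plus; [|exact Ed|].
    2:{ apply ex_pseries_scal; [apply Rmult_comm | exact E']. }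
    do 2 f_equal. apply PSeries_ext. intros n.
    unfold PS_plus, PS_scal, PS_decr_1, PS_derive, plus, scal; simpl.
    unfold mult; simpl. change (match n with O => 1 | S _ => INR n + 1 end)
      with (INR (S n)). rewrite S_INR, bS. pose proof (pos_INR n). field. lra. }
  assert (sq : forall x, Rabs x < 1 -> Rabs (x ^ 2) < 1).
  { intros x Hx. rewrite <- RPow_abs. pose proof (Rabs_pos x). nra. }
  set (f := fun x => x * g (x ^ 2)).
  assert (df : forall x, Rabs x < 1 -> is_derive f x (1 + (f x) ^ 2)).
  { intros x Hx. pose proof (sq x Hx) as Hs.
    pose proof (is_derive_PSeries b (x ^ 2) (rad _ Hs)) as Dg.
    pose proof (ode _ Hs) as O. unfold f.
    replace (1 + _) with
      (g (x ^ 2) + x * (2 * x * PSeries (PS_derive b) (x ^ 2))) by nra.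
    auto_derive.
    - exists (PSeries (PS_derive b) (x ^ 2)). exact Dg.
    - replace (x * (x * 1)) with (x ^ 2) by ring.
      replace (Derive _ (x ^ 2)) with (PSeries (PS_derive b) (x ^ 2))
        by (symmetry; apply is_derive_unique; exact Dg).
      ring. }
  assert (dh : forall x, Rabs x < 1 ->
    is_derive (fun t => atan (f t) - t) x 0).
  { intros x Hx. replace 0 with ((1 + f x ^ 2) * / (1 + Rsqr (f x)) - 1).
    2:{ unfold Rsqr. field. nra. }
    apply (is_derive_minus (fun t => atan (f t)) (fun t => t)).
    - apply (is_derive_comp atan f); [apply is_derive_atan | now apply df].
    - apply (is_derive_id (K := R_AbsRing)). }
  assert (h0 : atan (f 0) - 0 = 0).
  { unfold f. rewrite Rmult_0_l, atan_0. ring. }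
  assert (ft : forall x, Rabs x < 1 -> tan x = f x).
  { intros x Hx. assert (atan (f x) - x = 0) as Hx0.
    { rewrite <- h0. apply Rabs_lt_between in Hx.
      destruct (Rtotal_order x 0) as [Hlt|[->|Hgt]]; [|easy|].
      - apply (eq_is_derive (fun t => atan (f t) - t)); [|exact Hlt].
        intros t Ht. apply dh, Rabs_lt_between. lra.
      - symmetry. apply (eq_is_derive (fun t => atan (f t) - t)); [|exact Hgt].
        intros t Ht. apply dh, Rabs_lt_between. lra. }
    replace x with (atan (f x)) at 1 by lra. apply tan_atan. }
  exists (fun n => b (n - 1)%nat * INR (fact (2 * n - 1))).
  exists 1. split; [lra|]. intros x Hx. rewrite (ft x Hx).
  pose proof (PSeries_correct _ _ (CV_radius_inside _ _ (rad _ (sq x Hx)))) as S.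
  apply (is_series_scal x) in S.
  eapply is_series_ext; [|exact S].
  intros k. cbv beta zeta. rewrite pow_n_pow.
  replace (2 * Datatypes.S k - 1)%nat with (2 * k + 1)%nat by lia.
  replace (Datatypes.S k - 1)%nat with k by lia.
  change (x * ((x ^ 2) ^ k * b k) =
          b k * INR (fact (2 * k + 1)) *
          (x ^ (2 * k + 1) / INR (fact (2 * k + 1)))).
  rewrite pow_add, <- pow_mult. field. apply INR_fact_neq_0.
Qed.

(* Main.v *)
Require Import Defs.
From Stdlib Require Import Reals Lra Lia Factorial Wf_nat.
From Coquelicot Require Import Coquelicot.

(** Taking logarithms turns the operator [R] into the forward difference
    operator, so the claim is that [(-1)^r] times the [(r+2)]-th difference of
    [ln T(n)] is nonnegative for large [n].

    The pole of [tan] nearest to 0 dominates: [T(n)] is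
    [c * (2n-1)! * (4/pi^2)^n] up to a relative error that decays geometrically
    ([normalized_tan_coef_limit]).  Hence the first difference of [ln T(n)] is
    [ln n + ln (n + 1/2)] plus a constant plus a geometrically small term
    ([fdiff_ln_tangent_number]).  By the mean value theorem the differences of
    [ln] alternate in sign and are at least of the order of a negative power of
    [n] ([ln_fdiff_lower]); a geometric error cannot compete with that
    ([geometric_below_power]), so the sign of the logarithmic part prevails.

    The asymptotics are obtained without complex analysis.  Put
    [y = (2x/pi)^2], so that the pole sits at [y = 1], and let [B] be the power
    series in [y] of [tan x / x].  The zero of the cosine at [pi/2] means that
    [cos x = (1 - y) U(y)], where the coefficients of [U] are the partial sums of
    the series of [cos (pi/2) = 0], that is, its tails with a minus sign.  They
    are so small that [1/U] is analytic beyond [y = 1].  With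
    [D(y) = (1 - y) B(y)] the identity [cos x * tan x = sin x] reads
    [U * D = sin x / x], and solving this convolution equation for the
    coefficients of [D] bounds them by a convergent geometric progression
    ([renewal_bound]).  Those coefficients are the increments of the
    coefficients of [B], which therefore converge geometrically.  The limit
    [D(1)] is nonzero as [U(1) D(1) = sin (pi/2) / (pi/2)], and it is positive
    because the recurrence contained in [tan' = 1 + tan^2] makes all
    coefficients of [B] positive. *)

(** * Power series and sequences *)

Lemma Rabs_lt_CV_radius (a : nat -> R) (e y : R) :
  Rbar_le e (CV_radius a) -> Rabs y < e -> Rbar_lt (Rabs y) (CV_radius a).
Proof. intros He Hy. apply Rbar_lt_le_trans with e; assumption. Qed.

Lemma CV_radius_ge_bounded (a : nat -> R) (r M : R) :
  (forall n, Rabs (a n * r ^ n) <= M) -> Rbar_le r (CV_radius a).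
Proof. intros H. apply (proj1 (CV_radius_bounded a)). exists M. exact H. Qed.

Lemma CV_radius_ge_ex_pseries (a : nat -> R) (r : R) :
  ex_pseries a r -> Rbar_le r (CV_radius a).
Proof.
  intros H. apply ex_series_lim_0 in H.
  destruct (filterlim_bounded (K := R_AbsRing) (V := R_NormedModule)
    (fun n => scal (pow_n r n) (a n))) as [M HM].
  - exists 0. exact H.
  - apply CV_radius_ge_bounded with M. intros n.
    replace (a n * r ^ n) with (scal (pow_n r n) (a n)); [apply HM|].
    rewrite pow_n_pow. unfold scal; simpl; unfold mult; simpl. ring.
Qed.

(** The variable [y] below stands for a square, so identities are available
    for positive [y] only, while uniqueness of power series is usually stated
    for a two-sided neighbourhood.  Continuity at 0 gives the constant
    coefficients; removing them and dividing by [y] gives the others. *)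
Lemma PSeries_ext_right (e : R) : 0 < e -> forall (n : nat) (a b : nat -> R),
  Rbar_le e (CV_radius a) -> Rbar_le e (CV_radius b) ->
  (forall y, 0 < y < e -> PSeries a y = PSeries b y) -> a n = b n.
Proof.
  intros He.
  assert (H0 : forall a b : nat -> R,
    Rbar_le e (CV_radius a) -> Rbar_le e (CV_radius b) ->
    (forall y, 0 < y < e -> PSeries a y = PSeries b y) -> a O = b O).
  { intros a b Ha Hb H.
    rewrite <- (PSeries_0 a), <- (PSeries_0 b).
    assert (C : continuity_pt (fun y => PSeries a y - PSeries b y) 0).
    { apply continuity_pt_minus; apply PSeries_continuity;
        (eapply Rabs_lt_CV_radius; [eassumption|]); rewrite Rabs_R0; exact He. }
    destruct (Req_dec (PSeries a 0) (PSeries b 0)) as [|Hne]; [easy|exfalso].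
    destruct (C (Rabs (PSeries a 0 - PSeries b 0))) as [d [Hd HC]].
    { apply Rabs_pos_lt. lra. }
    set (y := Rmin d e / 2).
    assert (Hy : 0 < y < Rmin d e)
      by (unfold y; pose proof (Rmin_glb_lt _ _ _ Hd He); lra).
    pose proof (Rmin_l d e). pose proof (Rmin_r d e).
    specialize (HC y). simpl in HC. unfold Rdist in HC.
    rewrite (H y) in HC by lra.
    rewrite <- (Rabs_Ropp (PSeries a 0 - _)) in HC.
    apply (Rlt_irrefl (Rabs (- (PSeries a 0 - PSeries b 0)))).
    eapply Rle_lt_trans; [|apply HC].
    - right. f_equal. ring.
    - split.
      + split; [exact I|lra].
      + rewrite Rminus_0_r, Rabs_pos_eq; lra. }
  induction n as [|n IH]; intros a b Ha Hb H; [now apply H0|].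
  change (PS_decr_1 a n = PS_decr_1 b n).
  apply IH; try (rewrite CV_radius_decr_1; assumption).
  intros y Hy.
  assert (Hy' : Rabs y < e) by (rewrite Rabs_pos_eq; lra).
  pose proof (H y Hy) as E.
  rewrite (PSeries_decr_1 a), (PSeries_decr_1 b) in E
    by (apply CV_radius_inside; eapply Rabs_lt_CV_radius; eassumption).
  rewrite (H0 a b Ha Hb H) in E.
  apply Rmult_eq_reg_l with y; lra.
Qed.

Lemma CV_radius_ge_minus_incr (a : nat -> R) (e : R) :
  Rbar_le e (CV_radius a) -> Rbar_le e (CV_radius (PS_minus a (PS_incr_1 a))).
Proof.
  intros H. apply Rbar_le_trans with (2 := CV_radius_plus _ _).
  apply Rbar_min_case; [exact H|].
  change (Rbar_le e (CV_radius (PS_opp (PS_incr_1 a)))).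
  now rewrite CV_radius_opp, CV_radius_incr_1.
Qed.

Lemma PSeries_minus_incr (a : nat -> R) (y : R) :
  ex_pseries a y -> PSeries (PS_minus a (PS_incr_1 a)) y = (1 - y) * PSeries a y.
Proof.
  intros H. rewrite PSeries_minus, PSeries_incr_1; [ring|exact H|].
  now apply ex_pseries_incr_1.
Qed.

Lemma geometric_tail (a : nat -> R) (l A r : R) (N : nat) :
  0 <= r < 1 -> is_series a l ->
  (forall k, Rabs (a (S N + k)%nat) <= A * r ^ k) ->
  Rabs (l - sum_f_R0 a N) <= A / (1 - r).
Proof.
  intros Hr Ha Hb.
  assert (Hg : is_series (fun k => A * r ^ k) (A / (1 - r))).
  { apply (is_series_scal (K := R_AbsRing) (V := R_NormedModule) A).
    apply is_series_geom. rewrite Rabs_pos_eq; lra. }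
  assert (E : l - sum_f_R0 a N = Series (fun k => a (S N + k)%nat)).
  { rewrite <- (is_series_unique _ _ Ha).
    rewrite (Series_incr_n a (S N)); [simpl; ring|lia|now exists l]. }
  rewrite E.
  assert (Hex : ex_series (fun k => Rabs (a (S N + k)%nat))).
  { apply (ex_series_le (K := R_AbsRing) (V := R_CompleteNormedModule))
      with (fun k => A * r ^ k); [|eexists; exact Hg].
    intros k.
    change (Rabs (Rabs (a (S N + k)%nat)) <= A * r ^ k). rewrite Rabs_Rabsolu. apply Hb. }
  eapply Rle_trans; [apply Series_Rabs, Hex|].
  rewrite <- (is_series_unique _ _ Hg).
  apply Series_le; [|eexists; exact Hg].
  intros k. split; [apply Rabs_pos|apply Hb].
Qed.

Lemma geometric_convolution (r t : R) (n : nat) :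
  (t - r) * sum_f_R0 (fun k => r ^ k * t ^ (n - k)) n = t ^ S n - r ^ S n.
Proof.
  induction n as [|n IH]; [simpl; ring|].
  rewrite tech5, Nat.sub_diag.
  rewrite (sum_eq _ (fun k => r ^ k * t ^ (n - k) * t)).
  - rewrite <- scal_sum.
    transitivity (t * ((t - r) * sum_f_R0 (fun k => r ^ k * t ^ (n - k)) n)
      + (t - r) * r ^ S n); [simpl; ring|].
    rewrite IH. simpl. ring.
  - intros k Hk. replace (S n - k)%nat with (S (n - k)) by lia. simpl. ring.
Qed.

(** In [U * d = s] with [u 0 = 1] one has [d n = s n - sum_{k>=1} u k d (n-k)].
    If the earlier terms are bounded by [K t^j], the sum is at most
    [kappa K t^n] with [kappa = A / (t - r)], the value at [1/t] of the majorant
    of [U - 1].  As [kappa < 1], the induction closes for the [K] that solves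
    [K = 1 + kappa K]. *)
Lemma renewal_bound (u d s : nat -> R) (A r t : R) :
  0 <= A -> 0 <= r < t -> A < t - r ->
  u O = 1 -> (forall k, Rabs (u (S k)) <= A * r ^ k) ->
  (forall n, Rabs (s n) <= t ^ n) ->
  (forall n, PS_mult u d n = s n) ->
  forall n, Rabs (d n) <= / (1 - A / (t - r)) * t ^ n.
Proof.
  intros HA Hr Ht u0 Hu Hs Hd.
  set (kappa := A / (t - r)). set (K := / (1 - kappa)).
  assert (Hk : 0 <= kappa < 1).
  { unfold kappa. split; [apply Rdiv_le_0_compat; lra|].
    apply Rlt_div_l; lra. }
  assert (HK : K = 1 + kappa * K) by (unfold K; field; lra).
  assert (HKp : 0 < K) by (apply Rinv_0_lt_compat; lra).
  induction n as [n IH] using lt_wf_ind.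
  assert (Htn : 0 <= t ^ n) by (apply pow_le; lra).
  specialize (Hd n). unfold PS_mult in Hd. destruct n as [|m].
  { simpl in Hd. rewrite u0, Rmult_1_l in Hd. rewrite Hd.
    specialize (Hs O). simpl in *. nra. }
  rewrite decomp_sum in Hd by lia. cbn [Nat.pred] in Hd.
  rewrite u0, Nat.sub_0_r, Rmult_1_l in Hd.
  set (X := sum_f_R0 _ _) in Hd.
  assert (HX : Rabs X <= kappa * K * t ^ S m).
  { unfold X. eapply Rle_trans; [apply Rsum_abs|].
    eapply Rle_trans.
    - apply sum_Rle with
        (Bn := fun k => r ^ k * t ^ (m - k) * (A * K)). intros k Hkm.
      rewrite Rabs_mult. cbn [Nat.sub].
      replace (r ^ k * t ^ (m - k) * (A * K))
        with ((A * r ^ k) * (K * t ^ (m - k))) by ring.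
      apply Rmult_le_compat; try apply Rabs_pos; [apply Hu|].
      apply IH. lia.
    - rewrite <- scal_sum.
      replace (kappa * K * t ^ S m) with (A * K * (t ^ S m / (t - r)))
        by (unfold kappa; field; lra).
      apply Rmult_le_compat_l; [nra|].
      apply Rle_div_r; [lra|]. rewrite Rmult_comm, geometric_convolution.
      assert (0 <= r ^ S m) by (apply pow_le; lra). lra. }
  replace (d (S m)) with (s (S m) - X) by lra.
  eapply Rle_trans; [apply Rabs_triang|]. rewrite Rabs_Ropp.
  specialize (Hs (S m)). nra.
Qed.

(** * The cosine with its zero divided out *)

Definition quarter_pi_sq : R := (PI / 2) ^ 2.

Definition cos_coef (k : nat) : R := cos_n k * quarter_pi_sq ^ k.
Definition sin_coef (k : nat) : R := sin_n k * quarter_pi_sq ^ k.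

Lemma quarter_pi_sq_bounds : 0 < quarter_pi_sq <= 4.
Proof. unfold quarter_pi_sq. pose proof PI_RGT_0. pose proof PI_4. nra. Qed.

Lemma is_pseries_cos_coef (t : R) : is_pseries cos_coef (t ^ 2) (cos (PI / 2 * t)).
Proof.
  unfold cos. destruct (exist_cos _) as [l Hl].
  apply is_series_Reals in Hl. eapply is_series_ext; [|exact Hl].
  intros k. rewrite pow_n_pow.
  change (cos_n k * Rsqr (PI / 2 * t) ^ k = (t ^ 2) ^ k * cos_coef k).
  unfold cos_coef, quarter_pi_sq.
  replace (Rsqr (PI / 2 * t)) with (t ^ 2 * (PI / 2) ^ 2) by (unfold Rsqr; ring).
  rewrite Rpow_mult_distr. ring.
Qed.

Lemma is_pseries_sin_coef (t : R) : t <> 0 ->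
  is_pseries sin_coef (t ^ 2) (sin (PI / 2 * t) / (PI / 2 * t)).
Proof.
  intros Ht. pose proof PI_RGT_0. unfold sin. destruct (exist_sin _) as [l Hl].
  apply is_series_Reals in Hl.
  replace (_ / _) with l by (field; lra).
  eapply is_series_ext; [|exact Hl].
  intros k. rewrite pow_n_pow.
  change (sin_n k * Rsqr (PI / 2 * t) ^ k = (t ^ 2) ^ k * sin_coef k).
  unfold sin_coef, quarter_pi_sq.
  replace (Rsqr (PI / 2 * t)) with (t ^ 2 * (PI / 2) ^ 2) by (unfold Rsqr; ring).
  rewrite Rpow_mult_distr. ring.
Qed.

(** Passing from one Taylor coefficient of the sine or the cosine to the next
    multiplies it by [y / ((j+1)(j+2))]. *)
Lemma alternating_fact_step (y c r : R) (j k : nat) :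
  0 <= y -> y <= r * (INR (S j) * INR (S (S j))) ->
  Rabs ((-1) ^ k / INR (fact j) * y ^ k) <= c ->
  Rabs ((-1) ^ S k / INR (fact (S (S j))) * y ^ S k) <= r * c.
Proof.
  intros Hy Hr Hc.
  pose proof (lt_0_INR (S j) ltac:(lia)) as H1.
  pose proof (lt_0_INR (S (S j)) ltac:(lia)) as H2.
  pose proof (INR_fact_neq_0 j) as Hf.
  replace ((-1) ^ S k / INR (fact (S (S j))) * y ^ S k)
    with (- (y / (INR (S j) * INR (S (S j)))) * ((-1) ^ k / INR (fact j) * y ^ k)).
  2:{ rewrite !fact_simpl, !mult_INR, <- !tech_pow_Rmult. field. lra. }
  rewrite Rabs_mult, Rabs_Ropp.
  apply Rmult_le_compat; try apply Rabs_pos; [|exact Hc].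
  rewrite Rabs_pos_eq.
  - apply Rle_div_l; nra.
  - apply Rdiv_le_0_compat; nra.
Qed.

(** The ratio of consecutive coefficients is at most [4 / (5 * 6)] from the
    coefficient of index 2 on, and that one is at most [4^2 / 4!]. *)
Lemma cos_coef_bound (k : nat) : Rabs (cos_coef (S (S k))) <= (2 / 15) ^ k * (2 / 3).
Proof.
  pose proof quarter_pi_sq_bounds as HP.
  induction k as [|k IH].
  - unfold cos_coef, cos_n. simpl. rewrite Rabs_pos_eq; nra.
  - unfold cos_coef, cos_n. replace (2 * S (S (S k)))%nat with (S (S (2 * S (S k)))) by lia.
    rewrite <- (tech_pow_Rmult (2 / 15)), Rmult_assoc.
    apply alternating_fact_step; [lra| |exact IH].
    rewrite !S_INR, mult_INR, !S_INR. pose proof (pos_INR k). simpl (INR 0). nra.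
Qed.

Lemma sin_coef_bound (k : nat) : Rabs (sin_coef k) <= (2 / 3) ^ k.
Proof.
  pose proof quarter_pi_sq_bounds as HP.
  induction k as [|k IH].
  - unfold sin_coef, sin_n. simpl. rewrite Rabs_pos_eq; nra.
  - unfold sin_coef, sin_n. replace (2 * S k + 1)%nat with (S (S (2 * k + 1))) by lia.
    rewrite <- (tech_pow_Rmult (2 / 3)).
    apply alternating_fact_step; [lra| |exact IH].
    rewrite !S_INR, plus_INR, mult_INR. pose proof (pos_INR k). rewrite !S_INR. simpl (INR 0). nra.
Qed.

Lemma is_series_cos_coef : is_series cos_coef 0.
Proof.
  pose proof (is_pseries_cos_coef 1) as H.
  rewrite Rmult_1_r, cos_PI2 in H. eapply is_series_ext; [|exact H].
  intros k. rewrite pow_n_pow, !pow1. apply Rmult_1_l.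
Qed.

(** Multiplication by [1 / (1 - y)] replaces coefficients by their partial
    sums, so these are the coefficients of [cos (pi/2 sqrt y) / (1 - y)]. *)
Definition deflated_cos (k : nat) : R := sum_f_R0 cos_coef k.

Lemma cos_coef_0 : cos_coef 0 = 1.
Proof. unfold cos_coef, cos_n. simpl. field. Qed.

Lemma deflated_cos_0 : deflated_cos 0 = 1.
Proof. exact cos_coef_0. Qed.

(** As the whole series sums to [cos (pi/2) = 0], a partial sum is the
    opposite of a tail, and is no larger than a tail. *)
Lemma deflated_cos_bound (k : nat) :
  Rabs (deflated_cos (S k)) <= 10 / 13 * (2 / 15) ^ k.
Proof.
  replace (10 / 13 * (2 / 15) ^ k) with (2 / 3 * (2 / 15) ^ k / (1 - 2 / 15)) by field.
  replace (deflated_cos (S k)) with (- (0 - sum_f_R0 cos_coef (S k)))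
    by (unfold deflated_cos; ring).
  rewrite Rabs_Ropp.
  apply geometric_tail; [lra|exact is_series_cos_coef|].
  intros j. rewrite Rmult_assoc, <- pow_add, Rmult_comm. apply cos_coef_bound.
Qed.

Lemma deflated_cos_minus_incr (k : nat) :
  PS_minus deflated_cos (PS_incr_1 deflated_cos) k = cos_coef k.
Proof.
  unfold PS_minus, PS_incr_1, PS_plus, PS_opp, plus, opp, deflated_cos.
  destruct k; simpl; [unfold zero; simpl|]; ring.
Qed.

Lemma CV_radius_deflated_cos : Rbar_le 2 (CV_radius deflated_cos).
Proof.
  apply CV_radius_ge_bounded with 2. intros [|k].
  - rewrite deflated_cos_0. simpl. rewrite Rabs_pos_eq; lra.
  - rewrite Rabs_mult, (Rabs_pos_eq (2 ^ S k)) by (apply pow_le; lra).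
    apply Rle_trans with (10 / 13 * (2 / 15) ^ k * 2 ^ S k).
    + apply Rmult_le_compat_r; [apply pow_le; lra|apply deflated_cos_bound].
    + simpl. replace (10 / 13 * (2 / 15) ^ k * (2 * 2 ^ k))
        with (20 / 13 * ((2 / 15) ^ k * 2 ^ k)) by field.
      rewrite <- Rpow_mult_distr.
      assert (0 <= (2 / 15 * 2) ^ k <= 1).
      { split; [apply pow_le; lra|]. rewrite <- (pow1 k). apply pow_incr. lra. }
      lra.
Qed.

(** * The power series of the tangent *)

(** These are the coefficients of [tan x / x] in the variable
    [y = (2x/pi)^2], for which the nearest pole is at [y = 1]. *)
Definition normalized_tan_coef (T : nat -> R) (k : nat) : R :=
  T (S k) / INR (fact (2 * k + 1)) * quarter_pi_sq ^ k.

Definition tan_pseries_upto (T : nat -> R) (e : R) : Prop :=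
  0 < e < 1 /\ Rbar_le e (CV_radius (normalized_tan_coef T)) /\
  forall t, 0 < t -> t ^ 2 < e ->
    PI / 2 * t * PSeries (normalized_tan_coef T) (t ^ 2) = tan (PI / 2 * t).

Lemma tangent_numbers_pseries (T : nat -> R) :
  tangent_numbers T -> exists e, tan_pseries_upto T e.
Proof.
  intros [rho [Hrho H]]. pose proof PI_RGT_0 as Hpi.
  (* [t <= rho / pi] puts [pi/2 * t] inside the interval where the series
     converges to [tan], and [t < 1] keeps it left of the pole. *)
  set (t0 := Rmin (1 / 2) (rho / PI)).
  assert (Ht0 : 0 < t0 <= 1 / 2).
  { unfold t0. split; [apply Rmin_glb_lt; [lra|now apply Rdiv_lt_0_compat]|apply Rmin_l]. }
  assert (Hr0 : PI * t0 <= rho).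
  { unfold t0. pose proof (Rmin_r (1 / 2) (rho / PI)) as Hr.
    apply Rmult_le_compat_l with (r := PI) in Hr; [|lra].
    replace (PI * (rho / PI)) with rho in Hr by (field; lra). exact Hr. }
  assert (P : forall t, 0 < t <= t0 ->
    is_pseries (normalized_tan_coef T) (t ^ 2) (/ (PI / 2 * t) * tan (PI / 2 * t))).
  { intros t Ht.
    assert (Hx : Rabs (PI / 2 * t) < rho) by (rewrite Rabs_pos_eq; nra).
    eapply is_series_ext;
      [|apply (is_series_scal (K := R_AbsRing) (V := R_NormedModule)), (H _ Hx)].
    intros k. rewrite pow_n_pow. cbv zeta.
    change (/ (PI / 2 * t) * (T (S k) * ((PI / 2 * t) ^ (2 * S k - 1) / INR (fact (2 * S k - 1))))
      = (t ^ 2) ^ k * normalized_tan_coef T k).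
    replace (2 * S k - 1)%nat with (2 * k + 1)%nat by lia.
    unfold normalized_tan_coef, quarter_pi_sq.
    rewrite pow_add, pow_mult, !Rpow_mult_distr, pow_1. field.
    split; [apply INR_fact_neq_0|split; lra]. }
  exists (t0 ^ 2). split; [nra|split].
  - apply CV_radius_ge_ex_pseries. eexists. apply P. lra.
  - intros t Ht Hlt. assert (t < t0) by nra.
    rewrite (is_pseries_unique _ _ _ (P t ltac:(lra))). field. lra.
Qed.

Definition tan_coef_increment (T : nat -> R) : nat -> R :=
  PS_minus (normalized_tan_coef T) (PS_incr_1 (normalized_tan_coef T)).

Lemma sqrt_pos_square (y : R) : 0 < y -> exists t, 0 < t /\ t ^ 2 = y.
Proof.
  intros Hy. exists (sqrt y). split; [now apply sqrt_lt_R0|].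
  simpl. rewrite Rmult_1_r. apply sqrt_sqrt. lra.
Qed.

(** The factor [1 - y] moves from [B] to [U], where it restores the cosine;
    the identity is then [cos x * tan x = sin x]. *)
Lemma deflated_cos_mult_increment (T : nat -> R) : tangent_numbers T ->
  forall n, PS_mult deflated_cos (tan_coef_increment T) n = sin_coef n.
Proof.
  intros HT. destruct (tangent_numbers_pseries T HT) as [e [He [HB Htan]]].
  set (B := normalized_tan_coef T) in *. pose proof PI_RGT_0 as Hpi.
  assert (HD : Rbar_le e (CV_radius (tan_coef_increment T)))
    by now apply CV_radius_ge_minus_incr.
  assert (HU : Rbar_le e (CV_radius deflated_cos)).
  { apply Rbar_le_trans with 2; [simpl; lra|apply CV_radius_deflated_cos]. }
  assert (HS : Rbar_le e (CV_radius sin_coef)).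
  { apply Rbar_le_trans with (1 ^ 2); [simpl; lra|].
    apply CV_radius_ge_ex_pseries. eexists. apply is_pseries_sin_coef. lra. }
  assert (Hh : Rabs (e / 2) < e) by (rewrite Rabs_pos_eq; lra).
  intros n. apply (PSeries_ext_right (e / 2)); [lra| | |].
  - apply CV_radius_ge_ex_pseries, ex_pseries_mult; eapply Rabs_lt_CV_radius; eassumption.
  - apply Rbar_le_trans with e; [simpl; lra|exact HS].
  - intros y Hy. assert (Hy' : Rabs y < e) by (rewrite Rabs_pos_eq; lra).
    rewrite PSeries_mult by (eapply Rabs_lt_CV_radius; eassumption).
    unfold tan_coef_increment. rewrite PSeries_minus_incr
      by (apply CV_radius_inside; eapply Rabs_lt_CV_radius; eassumption).
    rewrite <- Rmult_assoc, (Rmult_comm (PSeries _ y)), <- PSeries_minus_incr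
      by (apply CV_radius_inside; eapply Rabs_lt_CV_radius; eassumption).
    rewrite (PSeries_ext _ cos_coef) by apply deflated_cos_minus_incr.
    destruct (sqrt_pos_square y) as [t [Ht <-]]; [lra|].
    rewrite (is_pseries_unique _ _ _ (is_pseries_cos_coef t)).
    rewrite (is_pseries_unique _ _ _ (is_pseries_sin_coef t ltac:(lra))).
    specialize (Htan t Ht ltac:(lra)). fold B.
    assert (Hc : 0 < cos (PI / 2 * t)) by (apply cos_gt_0; nra).
    apply Rmult_eq_reg_l with (PI / 2 * t); [|nra].
    transitivity (cos (PI / 2 * t) * tan (PI / 2 * t)); [rewrite <- Htan; ring|].
    unfold tan. field. lra.
Qed.

Lemma normalized_tan_coef_0 (T : nat -> R) : tangent_numbers T ->
  normalized_tan_coef T 0 = 1.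
Proof.
  intros HT. pose proof (deflated_cos_mult_increment T HT 0) as H.
  unfold PS_mult, sum_f_R0 in H. rewrite deflated_cos_0, Rmult_1_l in H.
  unfold tan_coef_increment, PS_minus, PS_plus, PS_opp, PS_incr_1, plus, opp, zero in H.
  unfold sin_coef, sin_n in H. simpl in H. lra.
Qed.

(** With [y = t^2] the differential equation [tan' = 1 + tan^2] becomes
    [B + 2 y B' = 1 + (pi/2)^2 y B^2].  As [B(0) = 1], dividing
    [B - 1 + 2 y B'] by [y] leaves a comparison of coefficients. *)
Lemma normalized_tan_coef_S (T : nat -> R) : tangent_numbers T -> forall n,
  (2 * INR n + 3) * normalized_tan_coef T (S n) =
  quarter_pi_sq * PS_mult (normalized_tan_coef T) (normalized_tan_coef T) n.
Proof.
  intros HT n. destruct (tangent_numbers_pseries T HT) as [e [He [HB Htan]]].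
  pose proof (normalized_tan_coef_0 T HT) as B0.
  set (B := normalized_tan_coef T) in *. pose proof PI_RGT_0 as Hpi.
  assert (HB' : Rbar_le e (CV_radius (PS_derive B))) by now rewrite CV_radius_derive.
  assert (HBd : Rbar_le e (CV_radius (PS_decr_1 B))) by now rewrite CV_radius_decr_1.
  assert (Hin : forall a y, Rbar_le e (CV_radius a) -> 0 < y < e -> ex_pseries a y).
  { intros a y Ha Hy. apply CV_radius_inside. eapply Rabs_lt_CV_radius; [exact Ha|].
    rewrite Rabs_pos_eq; lra. }
  assert (Hm : forall y, 0 < y < e -> Rbar_lt (Rabs y) (CV_radius B)).
  { intros y Hy. eapply Rabs_lt_CV_radius; [exact HB|]. rewrite Rabs_pos_eq; lra. }
  transitivity (PS_plus (PS_scal 2 (PS_derive B)) (PS_decr_1 B) n).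
  { unfold PS_plus, PS_scal, PS_derive, PS_decr_1.
    change (scal 2 (INR (S n) * B (S n))) with (2 * (INR (S n) * B (S n))).
    change plus with Rplus. rewrite S_INR. ring. }
  change (quarter_pi_sq * PS_mult B B n) with (PS_scal quarter_pi_sq (PS_mult B B) n).
  apply (PSeries_ext_right (e / 2)); [lra| | |].
  - apply CV_radius_ge_ex_pseries, ex_pseries_plus; [|now apply Hin; [|lra]].
    apply ex_pseries_scal; [apply Rmult_comm|now apply Hin; [|lra]].
  - apply CV_radius_ge_ex_pseries, ex_pseries_scal; [apply Rmult_comm|].
    apply ex_pseries_mult; apply Hm; lra.
  - intros y Hy. assert (Hy' : 0 < y < e) by lra.
    rewrite PSeries_plus; [|apply ex_pseries_scal; [apply Rmult_comm|]|]; try now apply Hin.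
    rewrite !PSeries_scal, PSeries_mult by now apply Hm.
    pose proof (PSeries_decr_1 B y (Hin _ _ HB Hy')) as Hd. rewrite B0 in Hd.
    destruct (sqrt_pos_square y) as [t [Ht <-]]; [lra|].
    assert (Hc : 0 < cos (PI / 2 * t)) by (apply cos_gt_0; nra).
    assert (D1 : is_derive (fun t => PI / 2 * t * PSeries B (t ^ 2)) t
      (PI / 2 * (PSeries B (t ^ 2) + 2 * t ^ 2 * PSeries (PS_derive B) (t ^ 2)))).
    { pose proof (is_derive_PSeries B (t ^ 2) (Hm _ Hy')) as D.
      auto_derive.
      - exists (PSeries (PS_derive B) (t ^ 2)). exact D.
      - replace (t * (t * 1)) with (t ^ 2) by ring.
        replace (Derive _ (t ^ 2)) with (PSeries (PS_derive B) (t ^ 2))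
          by (symmetry; apply is_derive_unique; exact D).
        field. }
    assert (D2 : is_derive (fun t => tan (PI / 2 * t)) t
      (PI / 2 * (tan (PI / 2 * t) ^ 2 + 1))).
    { apply (is_derive_comp tan (fun t => PI / 2 * t)).
      - apply is_derive_tan. lra.
      - auto_derive; [easy|ring]. }
    assert (E : PI / 2 * (PSeries B (t ^ 2) + 2 * t ^ 2 * PSeries (PS_derive B) (t ^ 2))
      = PI / 2 * (tan (PI / 2 * t) ^ 2 + 1)).
    { rewrite <- (is_derive_unique _ _ _ D1), <- (is_derive_unique _ _ _ D2).
      apply Derive_ext_loc.
      assert (Hs : t < sqrt e) by (rewrite <- (sqrt_pow2 t) by lra; apply sqrt_lt_1; lra).
      assert (Ho : locally t (fun s => 0 < s < sqrt e)).
      { apply open_and; [apply open_gt|apply open_lt|]. lra. }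
      revert Ho. apply filter_imp. intros s Hs'. apply Htan; [lra|].
      rewrite <- (pow2_sqrt e) by lra. nra. }
    rewrite <- (Htan t Ht ltac:(lra)) in E.
    apply Rmult_eq_reg_l in E; [|lra].
    apply Rmult_eq_reg_l with (t ^ 2); [|nra].
    unfold quarter_pi_sq. nra.
Qed.

Lemma sum_f_R0_pos (f : nat -> R) (n : nat) :
  (forall k, (k <= n)%nat -> 0 < f k) -> 0 < sum_f_R0 f n.
Proof.
  induction n as [|n IH]; intros H; [now apply H|].
  apply Rplus_lt_0_compat; [apply IH; intros k Hk|]; apply H; lia.
Qed.

Lemma normalized_tan_coef_pos (T : nat -> R) : tangent_numbers T ->
  forall n, 0 < normalized_tan_coef T n.
Proof.
  intros HT n. induction n as [n IH] using lt_wf_ind. destruct n as [|n].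
  - rewrite normalized_tan_coef_0 by exact HT. lra.
  - pose proof (normalized_tan_coef_S T HT n) as E. pose proof (pos_INR n).
    pose proof quarter_pi_sq_bounds as [HP _].
    apply Rmult_lt_reg_l with (2 * INR n + 3); [lra|].
    rewrite Rmult_0_r, E. apply Rmult_lt_0_compat; [exact HP|].
    apply sum_f_R0_pos. intros k Hk. apply Rmult_lt_0_compat; apply IH; lia.
Qed.

(** * Geometric convergence of the normalized coefficients *)

(** Any ratio below 1 and above [10/13 + 2/15], which is less than 0.903, would
    serve in place of [19/20]; the bound on [kappa] in [renewal_bound] asks for
    exactly that. *)
Lemma tan_coef_increment_bound (T : nat -> R) : tangent_numbers T ->
  exists K, forall n, Rabs (tan_coef_increment T n) <= K * (19 / 20) ^ n.
Proof.
  intros HT. eexists.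
  apply (renewal_bound deflated_cos _ sin_coef (10 / 13) (2 / 15)); try lra.
  - exact deflated_cos_0.
  - exact deflated_cos_bound.
  - intros n. eapply Rle_trans; [apply sin_coef_bound|]. apply pow_incr. lra.
  - now apply deflated_cos_mult_increment.
Qed.

Lemma sum_tan_coef_increment (T : nat -> R) (n : nat) :
  sum_f_R0 (tan_coef_increment T) n = normalized_tan_coef T n.
Proof.
  induction n as [|n IH].
  - unfold tan_coef_increment, PS_minus, PS_plus, PS_opp, PS_incr_1, plus, opp, zero.
    simpl. ring.
  - rewrite tech5, IH.
    unfold tan_coef_increment, PS_minus, PS_plus, PS_opp, PS_incr_1, plus, opp.
    simpl. ring.
Qed.

Lemma normalized_tan_coef_limit (T : nat -> R) : tangent_numbers T ->
  exists c K, 0 < c /\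
    forall n, Rabs (normalized_tan_coef T n - c) <= K * (19 / 20) ^ n.
Proof.
  intros HT. destruct (tan_coef_increment_bound T HT) as [K HK].
  pose proof PI_RGT_0 as Hpi.
  assert (HD : Rbar_le (20 / 19) (CV_radius (tan_coef_increment T))).
  { apply CV_radius_ge_bounded with K. intros n.
    rewrite Rabs_mult, (Rabs_pos_eq ((20 / 19) ^ n)) by (apply pow_le; lra).
    replace K with (K * (19 / 20) ^ n * (20 / 19) ^ n).
    - apply Rmult_le_compat_r; [apply pow_le; lra|apply HK].
    - rewrite Rmult_assoc, <- Rpow_mult_distr.
      replace (19 / 20 * (20 / 19)) with 1 by field. rewrite pow1. ring. }
  assert (H1 : Rbar_lt (Rabs 1) (CV_radius (tan_coef_increment T))).
  { eapply Rabs_lt_CV_radius; [exact HD|]. rewrite Rabs_R1. lra. }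
  assert (H1' : Rbar_lt (Rabs 1) (CV_radius deflated_cos)).
  { eapply Rabs_lt_CV_radius; [exact CV_radius_deflated_cos|]. rewrite Rabs_R1. lra. }
  set (c := PSeries (tan_coef_increment T) 1).
  assert (Hc : is_series (tan_coef_increment T) c).
  { pose proof (PSeries_correct _ _ (CV_radius_inside _ _ H1)) as S.
    eapply is_series_ext; [|exact S].
    intros n. cbv beta. rewrite pow_n_pow, pow1. apply Rmult_1_l. }
  assert (Hc0 : c <> 0).
  { intros E. pose proof (PSeries_mult _ _ 1 H1' H1) as M. fold c in M.
    rewrite E, Rmult_0_r, (PSeries_ext _ sin_coef) in M
      by now apply deflated_cos_mult_increment.
    pose proof (is_pseries_sin_coef 1 ltac:(lra)) as S.
    rewrite pow1, Rmult_1_r, sin_PI2 in S. apply is_pseries_unique in S.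
    rewrite S in M. revert M. apply Rgt_not_eq. apply Rdiv_lt_0_compat; lra. }
  exists c, (K * (19 / 20) / (1 - 19 / 20)). split.
  - assert (L : Rbar_le 0 c).
    { apply (is_lim_seq_le (fun _ => 0) (sum_n (tan_coef_increment T))).
      - intros n. rewrite sum_n_Reals, sum_tan_coef_increment.
        apply Rlt_le, normalized_tan_coef_pos, HT.
      - apply is_lim_seq_const.
      - exact Hc. }
    simpl in L. lra.
  - intros n. rewrite <- Rabs_Ropp, Ropp_minus_distr, <- sum_tan_coef_increment.
    replace (_ / _ * _) with (K * (19 / 20) ^ S n / (1 - 19 / 20)) by (simpl; field).
    apply geometric_tail; [lra|exact Hc|].
    intros k. rewrite Rmult_assoc, <- pow_add. apply HK.
Qed.

(** * Finite differences and logarithms *)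

Definition fdiff (f : nat -> R) (n : nat) : R := f (n + 1)%nat - f n.

Lemma iter_fdiff_ext (N : nat) (f g : nat -> R) :
  (forall n, (N <= n)%nat -> f n = g n) ->
  forall m n, (N <= n)%nat -> Nat.iter m fdiff f n = Nat.iter m fdiff g n.
Proof.
  intros H. induction m as [|m IH]; intros n Hn; [now apply H|].
  simpl. unfold fdiff at 1 3. now rewrite !IH by lia.
Qed.

Lemma iter_fdiff_plus (f g : nat -> R) (m n : nat) :
  Nat.iter m fdiff (fun k => f k + g k) n = Nat.iter m fdiff f n + Nat.iter m fdiff g n.
Proof.
  revert n. induction m as [|m IH]; intros n; [easy|].
  simpl. unfold fdiff at 1 3 5. rewrite !IH. ring.
Qed.

Lemma iter_fdiff_const (c : R) (m n : nat) : Nat.iter (S m) fdiff (fun _ => c) n = 0.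
Proof.
  revert n. induction m as [|m IH]; intros n; [simpl; unfold fdiff; ring|].
  rewrite Nat.iter_succ. unfold fdiff at 1. rewrite !IH. ring.
Qed.

Lemma iter_fdiff_bound (f : nat -> R) (N : nat) (K t : R) : 0 <= t <= 1 -> 0 <= K ->
  (forall n, (N <= n)%nat -> Rabs (f n) <= K * t ^ n) ->
  forall m n, (N <= n)%nat -> Rabs (Nat.iter m fdiff f n) <= 2 ^ m * K * t ^ n.
Proof.
  intros Ht HK H. induction m as [|m IH]; intros n Hn.
  - simpl. rewrite Rmult_1_l. now apply H.
  - simpl. unfold fdiff at 1.
    eapply Rle_trans; [apply Rabs_triang|]. rewrite Rabs_Ropp.
    pose proof (IH n Hn) as I1. pose proof (IH (n + 1)%nat ltac:(lia)) as I2.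
    assert (t ^ (n + 1) <= t ^ n).
    { rewrite pow_add, pow_1. pose proof (pow_le t n (proj1 Ht)). nra. }
    assert (0 <= 2 ^ m * K) by (apply Rmult_le_pos; [apply pow_le; lra|lra]).
    nra.
Qed.

(** The logarithm conjugates [ratio_op] to [fdiff]. *)
Lemma ln_iter_ratio (z : nat -> R) : (forall n, (1 <= n)%nat -> 0 < z n) ->
  forall m n, (1 <= n)%nat -> 0 < Nat.iter m ratio_op z n /\
    ln (Nat.iter m ratio_op z n) = Nat.iter m fdiff (fun k => ln (z k)) n.
Proof.
  intros Hz. induction m as [|m IH]; intros n Hn; [now split; [apply Hz|]|].
  simpl. unfold ratio_op at 1 3, fdiff at 1.
  destruct (IH n Hn) as [P0 <-]. destruct (IH (n + 1)%nat ltac:(lia)) as [P1 <-].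
  split; [now apply Rdiv_lt_0_compat|now apply ln_div].
Qed.

Lemma le_of_ln_le (x y : R) : 0 < x -> 0 < y -> ln x <= ln y -> x <= y.
Proof.
  intros Hx Hy H. destruct (Rle_or_lt x y) as [|Hlt]; [easy|].
  apply ln_increasing in Hlt; lra.
Qed.

(** Log-convexity and log-concavity of [a] are signs of the second difference
    of [ln a], and [ln] of the [r]-th iterate is an [r]-th difference. *)
Lemma almost_log_monotonic_of_fdiff (z : nat -> R) :
  (forall n, (1 <= n)%nat -> 0 < z n) ->
  (forall r, exists N, forall n, (N <= n)%nat ->
    0 <= (-1) ^ r * Nat.iter (S (S r)) fdiff (fun k => ln (z k)) n) ->
  almost_infinitely_log_monotonic z.
Proof.
  intros Hz H. split; [exact Hz|]. intros r. destruct (H r) as [N HN].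
  exists (S N). split; [lia|].
  pose proof (ln_iter_ratio z Hz r) as L. set (a := Nat.iter r ratio_op z) in *.
  assert (E : forall n, (1 <= n)%nat ->
    Nat.iter (S (S r)) fdiff (fun k => ln (z k)) n =
    ln (a n * a (n + 2)%nat) - ln (a (n + 1)%nat ^ 2)).
  { intros n Hn. set (F := Nat.iter r fdiff (fun k => ln (z k))) in *.
    change (F (n + 1 + 1)%nat - F (n + 1)%nat - (F (n + 1)%nat - F n) =
      ln (a n * a (n + 2)%nat) - ln (a (n + 1)%nat ^ 2)).
    replace (n + 1 + 1)%nat with (n + 2)%nat by lia.
    destruct (L n Hn) as [P0 <-]. destruct (L (n + 1)%nat ltac:(lia)) as [P1 <-].
    destruct (L (n + 2)%nat ltac:(lia)) as [P2 <-].
    rewrite ln_mult, ln_pow by assumption. simpl (INR 2). ring. }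
  assert (P : forall n, (1 <= n)%nat -> 0 < a n) by (intros n Hn; now apply L).
  assert (Psq : forall n, 0 < a (n + 1)%nat ^ 2)
    by (intros n; apply pow_lt, P; lia).
  assert (Ppr : forall n, (1 <= n)%nat -> 0 < a n * a (n + 2)%nat)
    by (intros n Hn; apply Rmult_lt_0_compat; apply P; lia).
  split; intros [q Hq]; (split; [intros n Hn; apply P; lia|]); intros n Hn;
    specialize (HN n ltac:(lia)); rewrite E, Hq in HN by lia;
    specialize (Psq n); specialize (Ppr n ltac:(lia)).
  - rewrite pow_1_even in HN. apply le_of_ln_le; lra.
  - rewrite Nat.add_1_r, pow_1_odd in HN. apply Rle_ge, le_of_ln_le; lra.
Qed.

(** The same difference operator on a real variable, where the mean value
    theorem applies. *)
Definition ln_fdiff (m : nat) : R -> R :=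
  Nat.iter m (fun f x => f (x + 1) - f x) ln.

Lemma iter_fdiff_ln (a : R) (m n : nat) :
  Nat.iter m fdiff (fun k => ln (INR k + a)) n = ln_fdiff m (INR n + a).
Proof.
  revert n. induction m as [|m IH]; intros n; [easy|].
  unfold ln_fdiff. rewrite !Nat.iter_succ. fold (ln_fdiff m). unfold fdiff at 1.
  rewrite !IH, plus_INR. simpl (INR 1). f_equal. f_equal. ring.
Qed.

Fixpoint rising (m : nat) (x : R) : R :=
  match m with O => x | S k => rising k x * (x + INR (S k)) end.

Lemma rising_bounds (m : nat) (x : R) : 0 < x ->
  0 < rising m x <= (x + INR m) ^ S m.
Proof.
  intros Hx. induction m as [|m IH]; [simpl; lra|].
  cbn [rising]. pose proof (lt_0_INR (S m) ltac:(lia)) as Hm.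
  split; [apply Rmult_lt_0_compat; lra|].
  rewrite <- (tech_pow_Rmult _ (S m)), Rmult_comm. apply Rmult_le_compat_l; [lra|].
  apply Rle_trans with (1 := proj2 IH). apply pow_incr.
  rewrite S_INR in *. pose proof (pos_INR m). lra.
Qed.

Lemma rising_shift (m : nat) (x : R) : rising m x * (x + INR (S m)) = x * rising m (x + 1).
Proof.
  induction m as [|m IH]; [simpl; ring|].
  cbn [rising]. rewrite IH, (S_INR (S m)). ring.
Qed.

(** The differences of [1/x] have a closed form. *)
Lemma is_derive_ln_fdiff (m : nat) (x : R) : 0 < x ->
  is_derive (ln_fdiff m) x ((-1) ^ m * INR (fact m) / rising m x).
Proof.
  revert x. induction m as [|m IH]; intros x Hx.
  - simpl. replace (1 * 1 / x) with (/ x) by (field; lra).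
    now apply is_derive_Reals, derivable_pt_lim_ln.
  - assert (D : is_derive (ln_fdiff (S m)) x
      ((-1) ^ m * INR (fact m) / rising m (x + 1) - (-1) ^ m * INR (fact m) / rising m x)).
    { apply (is_derive_minus (fun x => ln_fdiff m (x + 1)) (ln_fdiff m)); [|now apply IH].
      rewrite <- (Rmult_1_l (_ / rising m (x + 1))).
      apply (is_derive_comp (ln_fdiff m) (fun x => x + 1)); [apply IH; lra|].
      auto_derive; [easy|ring]. }
    replace ((-1) ^ S m * INR (fact (S m)) / rising (S m) x)
      with ((-1) ^ m * INR (fact m) / rising m (x + 1) - (-1) ^ m * INR (fact m) / rising m x);
      [exact D|].
    pose proof (rising_bounds m x Hx) as [R0 _].
    pose proof (rising_bounds m (x + 1) ltac:(lra)) as [R1 _].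
    pose proof (lt_0_INR (S m) ltac:(lia)) as Hm.
    pose proof (rising_shift m x) as E. cbn [rising].
    rewrite fact_simpl, mult_INR, <- tech_pow_Rmult.
    replace (rising m (x + 1)) with (rising m x * (x + INR (S m)) / x)
      by (rewrite E; field; lra).
    field. lra.
Qed.

(** One more difference is a derivative at an intermediate point, so a single
    use of the mean value theorem gives the sign and the size. *)
Lemma ln_fdiff_lower (m : nat) (x : R) : 0 < x ->
  / (x + INR (S m)) ^ S m <= (-1) ^ m * ln_fdiff (S m) x.
Proof.
  intros Hx.
  destruct (MVT_cor2 (ln_fdiff m) (fun y => (-1) ^ m * INR (fact m) / rising m y) x (x + 1))
    as [y [E Hy]]; [lra| |].
  { intros y Hy. apply is_derive_Reals, is_derive_ln_fdiff. lra. }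
  change (ln_fdiff (S m) x) with (ln_fdiff m (x + 1) - ln_fdiff m x). rewrite E.
  pose proof (rising_bounds m y ltac:(lra)) as [R0 R1].
  replace ((-1) ^ m * ((-1) ^ m * INR (fact m) / rising m y * (x + 1 - x)))
    with (INR (fact m) / rising m y).
  2:{ replace ((-1) ^ m * _) with (((-1) ^ m * (-1) ^ m) * (INR (fact m) / rising m y))
        by (field; lra).
      rewrite <- Rpow_mult_distr. replace (-1 * -1) with 1 by ring. rewrite pow1. ring. }
  apply Rle_trans with (/ rising m y).
  - apply Rinv_le_contravar; [exact R0|]. apply Rle_trans with (1 := R1).
    apply pow_incr. rewrite S_INR. pose proof (pos_INR m). lra.
  - rewrite <- (Rmult_1_l (/ _)). apply Rmult_le_compat_r.
    + now apply Rlt_le, Rinv_0_lt_compat.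
    + apply (le_INR 1). apply lt_O_fact.
Qed.

(** Bernoulli's inequality for [(1/t)^n]. *)
Lemma linear_geometric_bounded (C t : R) : 0 <= C -> 0 < t < 1 ->
  exists M, forall n, (INR n + C) * t ^ n <= M.
Proof.
  intros HC Ht. set (h := / t - 1).
  assert (Hh : 0 < h).
  { unfold h. pose proof (Rinv_lt_contravar t 1) as I. rewrite Rinv_1 in I. lra. }
  exists (C + / h). intros n.
  pose proof (poly n h Hh) as B. replace (1 + h) with (/ t) in B by (unfold h; ring).
  rewrite pow_inv in B. pose proof (pow_lt t n (proj1 Ht)) as Hp.
  pose proof (pos_INR n) as Hn.
  assert (B' : (1 + INR n * h) * t ^ n <= 1).
  { apply Rmult_le_compat_r with (r := t ^ n) in B; [|lra]. rewrite Rinv_l in B; lra. }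
  assert (Hi : 0 < / h) by now apply Rinv_0_lt_compat.
  apply Rle_trans with ((C + / h) * ((1 + INR n * h) * t ^ n)).
  - rewrite <- Rmult_assoc. apply Rmult_le_compat_r; [lra|].
    replace ((C + / h) * (1 + INR n * h)) with (INR n + C + / h + C * (INR n * h))
      by (field; lra).
    assert (0 <= C * (INR n * h)) by (repeat apply Rmult_le_pos; lra). lra.
  - rewrite <- (Rmult_1_r (C + / h)) at 2. apply Rmult_le_compat_l; lra.
Qed.

(** Writing [t = s^2] gives each further power of [n] its own factor
    [s^n]. *)
Lemma polynomial_geometric_bounded (C : R) (p : nat) : 0 <= C ->
  forall t, 0 < t < 1 -> exists M, forall n, (INR n + C) ^ p * t ^ n <= M.
Proof.
  intros HC. induction p as [|p IH]; intros t Ht.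
  - exists 1. intros n. simpl. rewrite Rmult_1_l, <- (pow1 n). apply pow_incr. lra.
  - destruct (sqrt_pos_square t) as [s [Hs <-]]; [lra|].
    assert (Hs1 : 0 < s < 1) by nra.
    destruct (IH s Hs1) as [M1 H1]. destruct (linear_geometric_bounded C s HC Hs1) as [M2 H2].
    exists (M2 * M1). intros n.
    replace ((INR n + C) ^ S p * (s ^ 2) ^ n)
      with (((INR n + C) * s ^ n) * ((INR n + C) ^ p * s ^ n))
      by (rewrite <- pow_mult, Nat.mul_comm, pow_mult; simpl; ring).
    pose proof (pos_INR n). pose proof (pow_lt s n Hs).
    apply Rmult_le_compat; [| |apply H2|apply H1]; apply Rmult_le_pos; try lra.
    apply pow_le. lra.
Qed.

Lemma geometric_below_power (K C t : R) (p : nat) : 0 < C -> 0 < t < 1 ->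
  exists N, forall n, (N <= n)%nat -> K * t ^ n <= / (INR n + C) ^ p.
Proof.
  intros HC Ht.
  (* One power more than needed supplies a factor tending to 0. *)
  destruct (polynomial_geometric_bounded C (S p) ltac:(lra) t Ht) as [M HM].
  destruct (INR_unbounded (Rabs K * M)) as [N HN].
  exists N. intros n Hn. apply le_INR in Hn. specialize (HM n).
  pose proof (pos_INR n) as Hn0. pose proof (pow_lt t n (proj1 Ht)) as Hp.
  set (X := INR n + C) in *. assert (HX : 0 < X) by (unfold X; lra).
  pose proof (pow_lt X p HX) as HXp.
  apply Rle_trans with (Rabs K * t ^ n).
  { apply Rmult_le_compat_r; [lra|apply Rle_abs]. }
  apply Rmult_le_reg_r with (X * X ^ p); [nra|].
  replace (/ X ^ p * (X * X ^ p)) with X by (field; lra).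
  apply Rle_trans with (Rabs K * M); [|unfold X; lra].
  replace (Rabs K * t ^ n * (X * X ^ p)) with (Rabs K * (X ^ S p * t ^ n)) by (simpl; ring).
  apply Rmult_le_compat_l; [apply Rabs_pos|exact HM].
Qed.

(** * Tangent numbers *)

Lemma ln_diff_le (x y : R) : 0 < x -> 0 < y -> ln x - ln y <= (x - y) / y.
Proof.
  intros Hx Hy. rewrite <- ln_div by assumption.
  assert (Hq : 0 < x / y) by now apply Rdiv_lt_0_compat.
  pose proof (exp_ineq1_le (ln (x / y))) as H. rewrite exp_ln in H by exact Hq.
  replace ((x - y) / y) with (x / y - 1) by (field; lra). lra.
Qed.

Lemma ln_diff_abs (x c : R) : 0 < c -> Rabs (x - c) <= c / 2 ->
  Rabs (ln x - ln c) <= 2 / c * Rabs (x - c).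
Proof.
  intros Hc H. assert (Hx : c / 2 <= x) by (apply Rabs_le_between in H; lra).
  assert (Hi : / x <= 2 / c).
  { replace (2 / c) with (/ (c / 2)) by (field; lra). apply Rinv_le_contravar; lra. }
  assert (Hi' : / c <= 2 / c).
  { unfold Rdiv. pose proof (Rinv_0_lt_compat c Hc). lra. }
  pose proof (Rinv_0_lt_compat c Hc) as Hc'.
  pose proof (Rinv_0_lt_compat x ltac:(lra)) as Hx'.
  pose proof (Rabs_pos (x - c)) as Ha.
  apply Rabs_le_between. split.
  - apply Ropp_le_cancel. rewrite Ropp_involutive, Ropp_minus_distr.
    eapply Rle_trans; [apply ln_diff_le; lra|]. rewrite Rmult_comm.
    apply Rle_trans with (Rabs (x - c) * / x).
    + apply Rmult_le_compat_r; [lra|]. rewrite Rabs_minus_sym. apply Rle_abs.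
    + now apply Rmult_le_compat_l.
  - eapply Rle_trans; [apply ln_diff_le; lra|]. rewrite Rmult_comm.
    apply Rle_trans with (Rabs (x - c) * / c).
    + apply Rmult_le_compat_r; [lra|]. apply Rle_abs.
    + now apply Rmult_le_compat_l.
Qed.

Lemma tangent_number_pos (T : nat -> R) : tangent_numbers T ->
  forall n, (1 <= n)%nat -> 0 < T n.
Proof.
  intros HT [|k] Hn; [lia|].
  pose proof (normalized_tan_coef_pos T HT k) as H. unfold normalized_tan_coef in H.
  pose proof (INR_fact_lt_0 (2 * k + 1)) as Hf.
  pose proof (pow_lt _ k (proj1 quarter_pi_sq_bounds)) as Hp.
  apply Rmult_lt_reg_r with (/ INR (fact (2 * k + 1)) * quarter_pi_sq ^ k).
  - apply Rmult_lt_0_compat; [now apply Rinv_0_lt_compat|exact Hp].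
  - rewrite Rmult_0_l, <- Rmult_assoc. exact H.
Qed.

(** The ratio of the factorials is [2n (2n+1) = 4 n (n + 1/2)].  The constant
    [ln c] cancels in the difference; it makes the last term small. *)
Lemma fdiff_ln_tangent_number (T : nat -> R) (c : R) : tangent_numbers T ->
  forall n, (1 <= n)%nat ->
  fdiff (fun k => ln (T k)) n =
  (ln (INR n + 0) + ln (INR n + 1 / 2)) +
  (ln (4 / quarter_pi_sq) +
   fdiff (fun k => ln (normalized_tan_coef T (k - 1)) - ln c) n).
Proof.
  intros HT [|k] Hn; [lia|]. unfold fdiff.
  rewrite Nat.add_1_r. cbn [Nat.sub]. rewrite Nat.sub_0_r.
  pose proof (normalized_tan_coef_pos T HT k) as B0.
  pose proof (normalized_tan_coef_pos T HT (S k)) as B1.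
  pose proof (tangent_number_pos T HT (S k) ltac:(lia)) as T0.
  pose proof (tangent_number_pos T HT (S (S k)) ltac:(lia)) as T1.
  pose proof quarter_pi_sq_bounds as [HP _]. pose proof (lt_0_INR (S k) ltac:(lia)) as Hk.
  assert (E : T (S (S k)) * normalized_tan_coef T k =
    T (S k) * (normalized_tan_coef T (S k) *
      ((INR (S k) + 0) * (INR (S k) + 1 / 2) * (4 / quarter_pi_sq)))).
  { unfold normalized_tan_coef. replace (2 * S k + 1)%nat with (S (S (2 * k + 1))) by lia.
    rewrite !fact_simpl, !mult_INR, <- tech_pow_Rmult.
    replace (INR (S (S (2 * k + 1)))) with (2 * (INR (S k) + 1 / 2))
      by (rewrite !S_INR, plus_INR, mult_INR; simpl; field).
    replace (INR (S (2 * k + 1))) with (2 * INR (S k))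
      by (rewrite !S_INR, plus_INR, mult_INR; simpl; field).
    field. repeat split; try lra. apply INR_fact_neq_0. }
  apply (f_equal ln) in E.
  assert (Hq : 0 < 4 / quarter_pi_sq) by (apply Rdiv_lt_0_compat; lra).
  set (q := 4 / quarter_pi_sq) in *.
  assert (H0 : 0 < INR (S k) + 0) by lra.
  assert (H1 : 0 < INR (S k) + 1 / 2) by lra.
  rewrite !ln_mult in E by auto using Rmult_lt_0_compat. lra.
Qed.

Lemma ln_normalized_tan_coef_bound (T : nat -> R) : tangent_numbers T ->
  exists c K N, 0 <= K /\ forall n, (N <= n)%nat ->
    Rabs (ln (normalized_tan_coef T (n - 1)) - ln c) <= K * (19 / 20) ^ n.
Proof.
  intros HT. destruct (normalized_tan_coef_limit T HT) as [c [K [Hc H]]].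
  (* The exponent 0 asks only that [K * 2 / c * (19 / 20) ^ n <= 1]. *)
  destruct (geometric_below_power (K * 2 / c) 1 (19 / 20) 0) as [N HN]; [lra|lra|].
  assert (HK : 0 <= K).
  { specialize (H O). simpl in H. pose proof (Rabs_pos (normalized_tan_coef T 0 - c)). lra. }
  exists c, (2 / c * K * (20 / 19)), (S N). split.
  { repeat apply Rmult_le_pos; try lra. now apply Rlt_le, Rinv_0_lt_compat. }
  intros [|n] Hn; [lia|]. cbn [Nat.sub]. rewrite Nat.sub_0_r.
  specialize (H n). specialize (HN n ltac:(lia)). rewrite pow_O, Rinv_1 in HN.
  assert (Hs : K * (19 / 20) ^ n <= c / 2).
  { apply Rmult_le_compat_r with (r := c / 2) in HN; [|lra].
    replace (K * 2 / c * (19 / 20) ^ n * (c / 2)) with (K * (19 / 20) ^ n) in HN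
      by (field; lra). lra. }
  eapply Rle_trans; [apply ln_diff_abs; lra|].
  replace (2 / c * K * (20 / 19) * (19 / 20) ^ S n) with (2 / c * (K * (19 / 20) ^ n))
    by (simpl; field; lra).
  apply Rmult_le_compat_l; [|exact H]. apply Rdiv_le_0_compat; lra.
Qed.

Theorem theorem3p11 (T : nat -> R) (hT : tangent_numbers T) :
  almost_infinitely_log_monotonic T.
Proof.
  apply almost_log_monotonic_of_fdiff; [now apply tangent_number_pos|].
  intros r. destruct (ln_normalized_tan_coef_bound T hT) as [c [K [N [HK He]]]].
  set (e := fun k => ln (normalized_tan_coef T (k - 1)) - ln c) in *.
  destruct (geometric_below_power (2 ^ S (S r) * K) (INR (S r)) (19 / 20) (S r))
    as [N' HN']; [apply lt_0_INR; lia|lra|].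
  exists (S (N + N')). intros n Hn.
  rewrite Nat.iter_succ_r, (iter_fdiff_ext 1 _ _ (fdiff_ln_tangent_number T c hT)) by lia.
  fold e. rewrite !iter_fdiff_plus, iter_fdiff_const, !iter_fdiff_ln.
  change (Nat.iter (S r) fdiff (fun k => fdiff e k) n) with (Nat.iter (S r) fdiff (fdiff e) n).
  rewrite <- Nat.iter_succ_r.
  pose proof (lt_0_INR n ltac:(lia)) as Hn0.
  pose proof (ln_fdiff_lower r (INR n + 0) ltac:(lra)) as L0.
  pose proof (ln_fdiff_lower r (INR n + 1 / 2) ltac:(lra)) as L1.
  rewrite Rplus_0_r in *.
  specialize (HN' n ltac:(lia)).
  pose proof (iter_fdiff_bound e N K (19 / 20) ltac:(lra) HK He (S (S r)) n ltac:(lia)) as B.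
  assert (B' : Rabs ((-1) ^ r * Nat.iter (S (S r)) fdiff e n) <= / (INR n + INR (S r)) ^ S r).
  { rewrite Rabs_mult, pow_1_abs, Rmult_1_l. lra. }
  apply Rabs_le_between in B'.
  assert (0 < / (INR n + 1 / 2 + INR (S r)) ^ S r).
  { apply Rinv_0_lt_compat, pow_lt. pose proof (pos_INR (S r)). lra. }
  lra.
Qed.
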